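(* Let $V$ be a discrete valuation domain with maximal ideal $\mathfrak{m}=\pi V$ and finite residue field of cardinality $q$, and let $u_n$, $F_n$, $\wp$, $\epsilon_j(u_n)$, $\mathcal{G}_n(x)$ and $e_j(n)$ be as defined in the context. Let $n$ be a nonnegative integer. Then, in $\mathbb{Z}[x]$, $$\mathcal{G}_n(x) \equiv \prod_{j=0}^{q-1} \mathcal{G}_j(x)^{e_j(n)} \pmod{(x^{q-1}-1)}.$$
   Context: $V$ is a discrete valuation domain with maximal ideal $\mathfrak{m}$, quotient field $K$, and finite residue field $V/\mathfrak{m}$ of cardinality $q$; $\pi$ is a generator of $\mathfrak{m}$. Fix elements $u_0,\ldots,u_{q-1}\in V$ with $u_0=0$ such that $R=\{u_0,\ldots,u_{q-1}\}$ is a complete set of representatives of $V$ modulo $\mathfrak{m}$ (one for each residue class). For an integer $n\ge 0$ with $q$-adic expansion $n=n_0+n_1q+\cdots+n_kq^k$, $0\le n_i\le q-1$, put $u_n=u_{n_0}+u_{n_1}\pi+\cdots+u_{n_k}\pi^k\in V$. Define $F_0(x)=1$ and, for $n\ge 1$, $$F_n(x)=\prod_{k=0}^{n-1}\frac{x-u_k}{u_n-u_k}\in K[x].$$ It is known that $F_n(V)\subseteq V$ for all $n\ge 0$. Fix $\wp\in V$ whose residue class generates the cyclic group $(V/\mathfrak{m})^{\times}$. For $n\in\mathbb{Z}_{\ge 0}$ and $j\in\mathbb{Z}$ define $$\epsilon_j(u_n)=\mathrm{card}\{m\in\mathbb{Z} \mid 0\le m\le n \text{ and } F_m(u_n)\equiv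 \wp^j \pmod{\mathfrak{m}}\}.$$ For each integer $n\ge 0$ the generating polynomial is $$\mathcal{G}_n(x)=\sum_{j=0}^{q-2}\epsilon_j(u_n)x^j\in\mathbb{Z}[x].$$ The integers $e_j(n)$, $0\le j\le q-1$, are defined as follows. For $n=0$: $e_0(0)=1$ and $e_j(0)=0$ for $1\le j\le q-1$. For $n>0$, write $n=\sum_{i=0}^r n_iq^i$ with $r\ge 0$, $n_i\in\{0,\ldots,q-1\}$ and $n_r>0$; then $e_j(n)$ is the number of indices $i\in\{0,\ldots,r\}$ with $n_i=j$. *)

(* Defs.v *)
From HB Require Import structures.
From mathcomp Require Import all_boot all_order all_algebra.
From mathcomp Require Import boolp.

Set Implicit Arguments.
Unset Strict Implicit.
Unset Printing Implicit Defensive.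

Import Order.TTheory GRing.Theory Num.Theory.
Local Open Scope ring_scope.

Local Notation "x %:F" := (tofrac x).

(* The value of [v] at 0 (conventionally +oo) is left irrelevant. *)
Definition discrete_valuation (K : fieldType) (v : K -> int) : Prop :=
  [/\ forall x y : K, x != 0 -> y != 0 -> v (x * y) = v x + v y,
      forall x y : K, x != 0 -> y != 0 -> x + y != 0 ->
        Num.min (v x) (v y) <= v (x + y)
    & forall k : int, exists2 x : K, x != 0 & v x = k].

Definition discrete_valuation_domain (V : idomainType) : Prop :=
  exists2 v : {fraction V} -> int, discrete_valuation v &
    forall x : {fraction V},
      (exists a : V, x = a%:F) <-> (x = 0 \/ 0 <= v x).

(* In a local ring the maximal ideal is the set of nonunits. *)
Definition max_ideal (V : idomainType) : pred V :=
  fun x => x \isn't a GRing.unit.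
Arguments max_ideal {V} x.

Definition max_ideal_generator (V : idomainType) (pi : V) : Prop :=
  forall x : V, max_ideal x <-> exists y : V, x = pi * y.

(* The entries of [r] are pairwise incongruent and meet every class, so the
   residue field has exactly [q] elements. *)
Definition residue_system (V : idomainType) (q : nat) (r : q.-tuple V) : Prop :=
  forall x : V, exists! i : 'I_q, max_ideal (x - tnth r i).

Definition residue_unit_generator (V : idomainType) (wp : V) : Prop :=
  ~~ max_ideal wp /\
  forall x : V, ~~ max_ideal x -> exists k : int, max_ideal (x - wp ^ k).

(* Least significant digit first; as [trunc_log q 0 = 0], [digits q 0] is
   [:: 0]. *)
Definition digits (q n : nat) : seq nat :=
  [seq ((n %/ q ^ i) %% q)%N | i <- iota 0 (trunc_log q n).+1].

Definition digit_count (q j n : nat) : nat := count_mem j (digits q n).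

Section GeneratingPolynomial.

Variables (V : idomainType) (pi : V) (q : nat) (r : q.-tuple V) (wp : V).

Definition useq (n : nat) : V :=
  \sum_(i < size (digits q n)) r`_(nth 0%N (digits q n) i) * pi ^+ i.

Definition Fpoly (n : nat) : {poly {fraction V}} :=
  \prod_(k < n) ((useq n - useq k)%:F^-1 *: ('X - (useq k)%:F%:P)).

(* The congruence is between elements of the fraction field, hence asks that
   the value of [Fpoly m] be the image of some [a] in [V]. *)
Definition epsilon (j : int) (n : nat) : nat :=
  #|[set m : 'I_n.+1 | `[< exists2 a : V,
      (Fpoly m).[(useq n)%:F] = a%:F & max_ideal (a - wp ^ j) >]]|.

Definition genpoly (n : nat) : {poly int} :=
  \sum_(j < q.-1) (epsilon j n)%:R *: 'X^j.

End GeneratingPolynomial.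

(* Main.v *)
(* Write n = n' q + n_0 and m = m' q + m_0, so that u_n = u_{n_0} + pi u_{n'}.
   In a block of q consecutive factors u_n - u_k, with k = k' q + k_0 and k'
   fixed, the factor k_0 = n_0 equals pi (u_{n'} - u_{k'}) and the others
   multiply, modulo pi, to the product of all nonzero residues.  Dividing by the
   same block for u_m leaves (u_{n'} - u_{k'}) / (u_{m'} - u_{k'}) times a unit
   congruent to 1, whence a Lucas congruence
     F_m(u_n) = F_{m'}(u_{n'}) F_{m_0}(u_{n_0})  (mod pi).
   Sending a unit congruent to wp^j to x^j and a nonunit to 0 is multiplicative
   modulo x^(q-1) - 1, and G_n is the sum of the images of the F_m(u_n) over
   any range of m containing [0, n], since F_m(u_n) = 0 for m > n.  Summing over
   both digits gives G_n = G_{n'} G_{n_0} modulo x^(q-1) - 1. *)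
Require Import Defs.
From mathcomp Require Import all_boot all_order all_algebra.
From mathcomp Require Import boolp ring zify.

Import GRing.Theory.
Local Open Scope ring_scope.

Set Implicit Arguments.
Unset Strict Implicit.
Unset Printing Implicit Defensive.

Local Notation "x %:F" := (tofrac x).

(** * Base-q digit lists *)

Lemma digits_small q n : (n < q)%N -> digits q n = [:: n].
Proof.
move=> ltnq; rewrite /digits.
have -> : trunc_log q n = 0%N.
  case: n ltnq => [|n] ltnq; first exact: trunc_log0.
  by apply: trunc_log_eq; [apply: leq_ltn_trans ltnq | rewrite expn1].
by rewrite /= expn0 divn1 modn_small.
Qed.

(** Positivity of n rules out a spurious leading zero: for n = 0 the right-hand side would be
    [[:: d; 0]]. *)
Lemma digits_rec q n d :
  (1 < q)%N -> (0 < n)%N -> (d < q)%N -> digits q (n * q + d) = d :: digits q n.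
Proof.
move=> q_gt1 n_gt0 ltdq; rewrite /digits.
have -> : trunc_log q (n * q + d) = (trunc_log q n).+1.
  have /andP[le_n lt_n] := trunc_log_bounds q_gt1 n_gt0.
  apply: trunc_log_eq => //; rewrite !expnSr in lt_n *; nia.
rewrite -[iota 0 _.+2]/(0%N :: iota (1 + 0) (trunc_log q n).+1) iotaDl.
rewrite map_cons -map_comp expn0 divn1 modnMDl modn_small //.
congr (_ :: _); apply: eq_map => i /=.
by rewrite add1n expnS divnMA divnMDl ?(ltnW q_gt1) // (divn_small ltdq) addn0.
Qed.

Lemma prod_digits (R : comPzSemiRingType) q n (f : nat -> R) :
  (0 < q)%N ->
  \prod_(d <- digits q n) f d = \prod_(j < q) f j ^+ digit_count q j n.
Proof.
move=> q_gt0; rewrite /digit_count; have : all (fun d => d < q)%N (digits q n).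
  by apply/allP => d /mapP[i _ ->]; rewrite ltn_pmod.
elim: (digits q n) => [_|d s IHs /= /andP[ltdq /IHs]].
  by rewrite big_nil big1.
rewrite big_cons => ->; under [RHS]eq_bigr do rewrite exprD.
rewrite big_split /=; congr (_ * _).
rewrite (bigD1 (Ordinal ltdq)) //= eqxx expr1 big1 ?mulr1 // => j.
by rewrite -val_eqE /= eq_sym => /negbTE ->.
Qed.

Section LucasCongruence.

Variables (V : idomainType) (pi : V) (q : nat) (r : q.-tuple V) (wp : V).
Hypothesis pi_gen : max_ideal_generator pi.

(** * Congruence modulo the maximal ideal *)

Definition congm (x y : V) := max_ideal (x - y).
Local Notation "x =m y" := (congm x y) (at level 70, no associativity).

Lemma max_idealM x y : @max_ideal V (x * y) = max_ideal x || max_ideal y.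
Proof. by rewrite /max_ideal unitrM negb_and. Qed.

Lemma max_idealN x : @max_ideal V (- x) = max_ideal x.
Proof. by rewrite /max_ideal unitrN. Qed.

Lemma max_ideal1 : @max_ideal V 1 = false.
Proof. by rewrite /max_ideal unitr1. Qed.

Lemma max_ideal0 : max_ideal (0 : V).
Proof. by rewrite /max_ideal unitr0. Qed.

Lemma max_ideal_pi : max_ideal pi.
Proof. by apply/pi_gen; exists 1; rewrite mulr1. Qed.

Lemma max_idealD x y : @max_ideal V x -> max_ideal y -> max_ideal (x + y).
Proof.
move=> /pi_gen[a ->] /pi_gen[b ->]; apply/pi_gen; exists (a + b).
by rewrite mulrDr.
Qed.

Lemma congm_refl x : x =m x.
Proof. by rewrite /congm subrr max_ideal0. Qed.

Lemma congm_sym x y : (x =m y) = (y =m x).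
Proof. by rewrite /congm -max_idealN opprB. Qed.

Lemma congm_trans y x z : x =m y -> y =m z -> x =m z.
Proof. by move=> xy /(max_idealD xy); rewrite /congm addrA subrK. Qed.

Lemma congmM x y z t : x =m y -> z =m t -> x * z =m y * t.
Proof.
rewrite /congm => xy zt; rewrite -(subrK (y * z) (x * z)) -addrA.
by rewrite -mulrBl -mulrBr max_idealD ?max_idealM ?xy ?zt ?orbT.
Qed.

Lemma congm_prod I (s : seq I) (P : pred I) (f g : I -> V) :
  (forall i, P i -> f i =m g i) ->
  \prod_(i <- s | P i) f i =m \prod_(i <- s | P i) g i.
Proof.
move=> fg; apply: (big_rec2 congm (congm_refl 1)) => i x y Pi xy.
exact: congmM (fg _ Pi) xy.
Qed.

Lemma congmX n x y : x =m y -> x ^+ n =m y ^+ n.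
Proof.
move=> xy; elim: n => [|n IHn]; first exact: congm_refl.
by rewrite !exprS congmM.
Qed.

Lemma congm_max_ideal x y : x =m y -> max_ideal x = max_ideal y.
Proof.
have imp a b : a =m b -> max_ideal b -> max_ideal a.
  by move=> ab mb; rewrite -(subrK b a) max_idealD.
by move=> xy; apply/idP/idP; apply: imp; rewrite // congm_sym.
Qed.

Lemma congm_mul2r z x y : ~~ max_ideal z -> (x * z =m y * z) = (x =m y).
Proof. by move=> /negbTE uz; rewrite /congm -mulrBl max_idealM uz orbF. Qed.

Lemma congm_div1 x y : x =m y -> ~~ max_ideal y -> x / y =m 1.
Proof.
move=> xy uy; rewrite -(congm_mul2r _ _ uy) mul1r divrK //.
by rewrite negbK in uy.
Qed.

Lemma congm_addpi x y : x + pi * y =m x.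
Proof. by rewrite /congm addrC addKr max_idealM max_ideal_pi. Qed.

(** * Residue classes and products over them *)

Hypothesis r_sys : residue_system r.

Lemma residue_map :
  exists f : V -> 'I_q, forall x i, (f x == i) = (x =m tnth r i).
Proof.
have /choice[f fP] : forall x, exists i, unique (fun i => x =m tnth r i) i.
  by move=> x; have [i iP] := r_sys x; exists i.
exists f => x i; have [fx fu] := fP x.
by apply/eqP/idP => [<- //|]; apply: fu.
Qed.

Lemma residue_map_congm (f : V -> 'I_q) :
  (forall x i, (f x == i) = (x =m tnth r i)) ->
  forall x y, (f x == f y) = (x =m y).
Proof.
move=> fP x y; have fy : y =m tnth r (f y) by rewrite -fP.
rewrite fP; apply/idP/idP => h; first by apply: congm_trans h _; rewrite congm_sym.
exact: congm_trans h fy.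
Qed.

Lemma residue_inj i j : tnth r i =m tnth r j -> i = j.
Proof.
have [f fP] := residue_map; rewrite -(residue_map_congm fP) => /eqP.
suff fr k : f (tnth r k) = k by rewrite !fr.
by apply/eqP; rewrite fP congm_refl.
Qed.

(** Translation by r_j - r_i permutes the residue classes and carries class i to class j, so it
    matches the two products factor by factor. *)
Lemma prod_residue_diff i j :
  \prod_(k < q | k != i) (tnth r i - tnth r k)
    =m \prod_(k < q | k != j) (tnth r j - tnth r k).
Proof.
have [f fP] := residue_map.
pose s k := f (tnth r k + (tnth r j - tnth r i)).
have sP k : tnth r k + (tnth r j - tnth r i) =m tnth r (s k) by rewrite -fP.
have s_inj : injective s.
  move=> k l /eqP; rewrite (residue_map_congm fP) /congm opprD addrACA.
  by rewrite subrr addr0 => /residue_inj.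
have si : s i = j by apply/eqP; rewrite fP addrC subrK congm_refl.
rewrite [X in _ =m X](reindex_inj s_inj) /=.
rewrite [X in _ =m X](eq_bigl (fun k => k != i)); last first.
  by move=> k; rewrite -si (inj_eq s_inj).
apply: congm_prod => k _; rewrite congm_sym.
have := sP k; rewrite /congm; congr max_ideal.
ring.
Qed.

(** The classes of 0 and 1 differ because 1 is a unit. *)
Lemma residue_card_gt1 : (1 < q)%N.
Proof.
have [[i ltiq] _] := r_sys 0; rewrite ltnNge; apply/negP => leq1.
have [f fP] := residue_map.
have : f 0 = f 1 by apply: ord_inj; case: (f 0) (f 1) => [a ?] [b ?] /=; lia.
move/eqP; rewrite (residue_map_congm fP) /congm sub0r max_idealN.
by rewrite max_ideal1.
Qed.

(** * The sequence u_n and the Lucas congruence for the values F_m(u_n) *)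

Hypothesis pi_neq0 : pi != 0.
Hypothesis r0 : r`_0 = 0.

Let q_gt1 := residue_card_gt1.
Let q_gt0 : (0 < q)%N := ltnW q_gt1.

Local Notation u := (useq pi r).

Lemma useq_small n : (n < q)%N -> u n = r`_n.
Proof.
by move=> ltnq; rewrite /useq digits_small //= big_ord1 expr0 mulr1.
Qed.

Lemma useq_rec n d : (d < q)%N -> u (n * q + d) = r`_d + pi * u n.
Proof.
(* For n = 0 the digit list does not grow, but the extra term [pi * u 0] vanishes since r_0 = 0. *)
case: n => [|n] ltdq; first by rewrite mul0n !useq_small // r0 mulr0 addr0.
rewrite /useq digits_rec //= big_ord_recl expr0 mulr1; congr (_ + _).
rewrite mulr_sumr; apply: eq_bigr => i _.
by rewrite exprS mulrCA.
Qed.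

Local Notation Fval m n := (Fpoly pi r m).[(u n)%:F].

Lemma FvalE m n : Fval m n = \prod_(k < m) ((u n - u k)%:F / (u m - u k)%:F).
Proof.
rewrite horner_prod; apply: eq_bigr => k _.
by rewrite hornerZ !hornerE !tofracB mulrC.
Qed.

Lemma Fval_eq0 m n : (n < m)%N -> Fval m n = 0.
Proof.
by move=> ltnm; rewrite FvalE (bigD1 (Ordinal ltnm)) //= subrr tofrac0 !mul0r.
Qed.

Lemma tofrac_div (x y : V) : ~~ max_ideal y -> (x / y)%:F = x%:F / y%:F.
Proof. by rewrite negbK => uy; rewrite rmorphM rmorphV. Qed.

Lemma residue_unit_diff i j :
  (i < q)%N -> (j < q)%N -> i != j -> ~~ max_ideal (r`_i - r`_j).
Proof.
move=> ltiq ltjq; apply: contra => rij.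
have := @residue_inj (Ordinal ltiq) (Ordinal ltjq).
by rewrite /congm !(tnth_nth 0) => /(_ rij) [->].
Qed.

(** The cofactor [w] collects the factors with i different from d, each congruent to r_d - r_i.
    Normalising its residue to the case d = 0 makes it independent of n, d and k, so that it cancels
    between two blocks. *)
Lemma prod_block n d k : (d < q)%N ->
  exists2 w : V,
    \prod_(i < q) (u (n * q + d) - u (k * q + i)) = pi * (u n - u k) * w &
    w =m \prod_(i < q | i != Ordinal q_gt0) (0 - tnth r i).
Proof.
move=> ltdq; pose d' := Ordinal ltdq.
exists (\prod_(i < q | i != d') (u (n * q + d) - u (k * q + i))).
  by rewrite (bigD1 d') //= !useq_rec //; congr (_ * _); ring.
have -> : 0 = tnth r (Ordinal q_gt0) by rewrite (tnth_nth 0) r0.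
apply: congm_trans (prod_residue_diff d' _).
apply: congm_prod => i _; rewrite !useq_rec // !(tnth_nth 0) /=.
have -> : r`_d + pi * u n - (r`_i + pi * u k) = r`_d - r`_i + pi * (u n - u k).
  by ring.
exact: congm_addpi.
Qed.

(** The exact factorisation through [a] holds in the fraction field before F_m(u_n) is known to lie
    in V; integrality is then deduced from it. *)
Lemma Fval_rec m n c d : (c < q)%N -> (d < q)%N ->
  exists a b : V, [/\ Fval (m * q + c) (n * q + d) = Fval m n * a%:F,
    Fval c d = b%:F & a =m b].
Proof.
move=> ltcq ltdq.
pose W : V := \prod_(i < q | i != Ordinal q_gt0) (0 - tnth r i).
have unitW : ~~ max_ideal W.
  rewrite negbK; apply: rpred_prod => i ne_i0.
  have := residue_unit_diff q_gt0 (ltn_ord i).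
  by rewrite r0 (tnth_nth 0) eq_sym => /(_ ne_i0); rewrite negbK.
have blocks k : exists2 a : V, a =m 1 &
    \prod_(i < q) ((u (n * q + d) - u (k * q + i))%:F
      / (u (m * q + c) - u (k * q + i))%:F)
    = (u n - u k)%:F / (u m - u k)%:F * a%:F.
  have [w1 e1 w1W] := prod_block n k ltdq.
  have [w2 e2 w2W] := prod_block m k ltcq.
  have u2 : ~~ max_ideal w2 by rewrite (congm_max_ideal w2W).
  exists (w1 / w2).
    by apply: congm_div1 u2; apply: congm_trans w1W _; rewrite congm_sym.
  rewrite prodf_div -!rmorph_prod e1 e2 tofrac_div //= !rmorphM invfM.
  have pi_unit : pi%:F != 0 by rewrite tofrac_eq0.
  by rewrite !invfM [LHS]mulrACA; congr (_ * _); rewrite mulrACA divff // mul1r.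
have /choice[A AP] : forall k, exists a : V, a =m 1 /\
    \prod_(i < q) ((u (n * q + d) - u (k * q + i))%:F
      / (u (m * q + c) - u (k * q + i))%:F)
    = (u n - u k)%:F / (u m - u k)%:F * a%:F.
  by move=> k; have [a a1 aE] := blocks k; exists a.
have den (i : 'I_c) : ~~ max_ideal (r`_c - r`_i).
  have ltic := ltn_ord i; apply: residue_unit_diff => //.
    exact: ltn_trans ltic ltcq.
  by rewrite gtn_eqF.
(* [b] is F_c(u_d) computed in V, and [b'] is the contribution of the last, incomplete block k = m q
   + i with i < c; their numerators differ by multiples of pi. *)
pose b : V := \prod_(i < c) ((r`_d - r`_i) / (r`_c - r`_i)).
pose b' : V := \prod_(i < c) ((r`_d - r`_i + pi * (u n - u m)) / (r`_c - r`_i)).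
exists ((\prod_(k < m) A k) * b'), b; split.
- rewrite !FvalE.
  (* The range of k is cut at m q: m complete blocks, then a tail of c factors. *)
  rewrite -(big_mkord xpredT (fun k => (u (n * q + d) - u k)%:F
     / (u (m * q + c) - u k)%:F)).
  rewrite (@big_cat_nat _ _ _ (m * q)) ?leq_addr //= big_nat_mul big_mkord.
  rewrite rmorphM mulrA rmorph_prod -big_split /=; congr (_ * _).
    apply: eq_bigr => k _; have [_ <-] := AP k.
    rewrite -{1}[(k * q)%N]add0n big_addn mulSn addnK big_mkord.
    by apply: eq_bigr => i _; rewrite (addnC i).
  rewrite -{1}[(m * q)%N]add0n big_addn addKn big_mkord rmorph_prod.
  apply: eq_bigr => i _; have ltiq := ltn_trans (ltn_ord i) ltcq.
  rewrite (addnC i) !useq_rec //= tofrac_div //.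
  by congr (_%:F / _%:F); ring.
- rewrite FvalE rmorph_prod; apply: eq_bigr => i _.
  have ltiq := ltn_trans (ltn_ord i) ltcq.
  by rewrite /= tofrac_div // !useq_small.
- rewrite -[X in _ =m X]mul1r; apply: congmM.
    apply: (big_ind (congm^~ 1)) => [|x y x1 y1|k _].
    - exact: congm_refl.
    - by rewrite -(mulr1 1) congmM.
    - by have [] := AP k.
  apply: congm_prod => i _; apply: congmM (congm_refl _).
  exact: congm_addpi.
Qed.

(** Strong induction on m, removing the last digit with [Fval_rec]; when m < q the remaining factor
    is F_0 = 1. *)
Lemma Fval_integral m n : exists a : V, Fval m n = a%:F.
Proof.
elim/ltn_ind: m n => m IHm n.
have [ltmq|leqm] := ltnP m q.
  have [a [b [E _ _]]] := Fval_rec 0 (n %/ q) ltmq (ltn_pmod n q_gt0).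
  exists a; move: E; rewrite -divn_eq add0n => ->.
  by rewrite FvalE big_ord0 mul1r.
have lt_div : (m %/ q < m)%N by rewrite ltn_Pdiv // (leq_trans q_gt0).
have [a [b [E _ _]]] :=
  Fval_rec (m %/ q) (n %/ q) (ltn_pmod m q_gt0) (ltn_pmod n q_gt0).
have [c cE] := IHm _ lt_div (n %/ q)%N.
by exists (c * a); rewrite tofracM -cE -E -!divn_eq.
Qed.

(** * Discrete logarithms of residues to the base [wp] *)

Hypothesis wp_gen : residue_unit_generator wp.

Let unit_wp : ~~ max_ideal wp := wp_gen.1.

Lemma unit_wpX k : ~~ max_ideal (wp ^+ k).
Proof. by rewrite negbK rpredX // -[_ \in _]negbK. Qed.

(** Multiplication by [wp] permutes the q - 1 nonzero classes; their product [W] is a unit and can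
    be cancelled. *)
Lemma fermat_wp : wp ^+ q.-1 =m 1.
Proof.
have [f fP] := residue_map.
have fM := residue_map_congm fP.
pose s k := f (wp * tnth r k); pose i0 := Ordinal q_gt0.
have sP k : wp * tnth r k =m tnth r (s k) by rewrite -fP.
have ri0 : tnth r i0 = 0 by rewrite (tnth_nth 0) r0.
have s_inj : injective s.
  move=> k l /eqP; rewrite fM ![wp * _]mulrC congm_mul2r //.
  exact: residue_inj.
have s0 : s i0 = i0 by apply/eqP; rewrite fP ri0 mulr0 congm_refl.
pose W := \prod_(k < q | k != i0) tnth r k.
have unitW : ~~ max_ideal W.
  rewrite negbK; apply: rpred_prod => i ne_i0.
  have := residue_unit_diff (ltn_ord i) q_gt0 ne_i0.
  by rewrite r0 subr0 (tnth_nth 0) negbK.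
rewrite -(congm_mul2r _ _ unitW) mul1r {2}/W (reindex_inj s_inj) /=.
rewrite [X in _ =m X](eq_bigl (fun k => k != i0)); last first.
  by move=> k; rewrite -[in LHS]s0 (inj_eq s_inj).
have -> : wp ^+ q.-1 * W = \prod_(k < q | k != i0) (wp * tnth r k).
  rewrite big_split /= prodr_const; congr (wp ^+ _ * _).
  by rewrite (eq_card (B := [set~ i0])) ?cardsC1 ?card_ord // => k; rewrite !inE.
by apply: congm_prod => k _; apply: sP.
Qed.

Lemma wpX_modn k : wp ^+ k =m wp ^+ (k %% q.-1).
Proof.
rewrite [in X in X =m _](divn_eq k q.-1) exprD mulnC exprM.
rewrite -[X in _ =m X]mul1r; apply: congmM (congm_refl _).
by rewrite -(expr1n _ (k %/ q.-1)); apply/congmX/fermat_wp.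
Qed.

Lemma dlog_exists x : ~~ max_ideal x -> exists j : 'I_q.-1, x =m wp ^+ j.
Proof.
have q1_gt0 : (0 < q.-1)%N by rewrite -ltnS prednK.
have reduce k : x =m wp ^+ k -> exists j : 'I_q.-1, x =m wp ^+ j.
  move=> xk; exists (Ordinal (ltn_pmod k q1_gt0)).
  exact: congm_trans xk (wpX_modn k).
move=> /wp_gen.2[[k|k] xk]; first exact: reduce k xk.
(* A negative exponent -(k+1) is replaced by (k+1)(q-2): the two differ by (k+1)(q-1), a multiple of
   the period. *)
apply: (reduce (k.+1 * q.-2)%N); apply: congm_trans xk _.
have uk : wp ^+ k.+1 \is a GRing.unit by have := unit_wpX k.+1; rewrite negbK.
rewrite NegzE -exprnN congm_sym.
suff: wp ^+ (k.+1 * q.-2) * wp ^+ k.+1 =m 1.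
  by rewrite -(mulVr uk) congm_mul2r // unit_wpX.
rewrite -exprD -mulnSr prednK // mulnC exprM -(expr1n _ k.+1).
exact/congmX/fermat_wp.
Qed.

(** By [dlog_exists] the q - 1 exponents reach all q - 1 nonzero classes, so counting forces
    injectivity. *)
Lemma dlog_inj (i j : 'I_q.-1) : wp ^+ i =m wp ^+ j -> i = j.
Proof.
have [f fP] := residue_map; have fM := residue_map_congm fP.
rewrite -fM => /eqP; pose g (k : 'I_q.-1) := f (wp ^+ k).
suff /imset_injP g_inj : #|g @: setT| == #|[set: 'I_q.-1]| by apply: g_inj.
rewrite eqn_leq leq_imset_card cardsT card_ord.
have {1}<- : #|[set~ Ordinal q_gt0]| = q.-1 by rewrite cardsC1 card_ord.
apply/subset_leq_card/subsetP => k; rewrite !inE => ne_k0.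
have := residue_unit_diff (ltn_ord k) q_gt0 ne_k0.
rewrite r0 subr0 -[r`_k]/(r`_(val k)) -(tnth_nth 0).
move=> /dlog_exists[l kl]; apply/imsetP; exists l => //.
by apply/eqP; rewrite eq_sym fP congm_sym.
Qed.

(** * Congruence modulo x^(q-1) - 1 and the map from residues to monomials *)

Definition eqXn1 (p p' : {poly int}) := exists H, p - p' = H * ('X^(q.-1) - 1).
Local Notation "p =x p'" := (eqXn1 p p') (at level 70, no associativity).

Lemma eqXn1_refl p : p =x p.
Proof. by exists 0; rewrite subrr mul0r. Qed.

Lemma eqXn1_trans p2 p1 p3 : p1 =x p2 -> p2 =x p3 -> p1 =x p3.
Proof.
by move=> [H1 E1] [H2 E2]; exists (H1 + H2); rewrite mulrDl -E1 -E2 addrA subrK.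
Qed.

Lemma eqXn1_sym p1 p2 : p1 =x p2 -> p2 =x p1.
Proof. by move=> [H E]; exists (- H); rewrite mulNr -E opprB. Qed.

Lemma eqXn1M p1 p2 p3 p4 : p1 =x p2 -> p3 =x p4 -> p1 * p3 =x p2 * p4.
Proof.
move=> [H1 E1] [H2 E2]; exists (H1 * p3 + p2 * H2).
by rewrite mulrDl mulrAC -E1 -mulrA -E2; ring.
Qed.

Lemma eqXn1_sum I (s : seq I) (f g : I -> {poly int}) :
  (forall i, f i =x g i) -> \sum_(i <- s) f i =x \sum_(i <- s) g i.
Proof.
move=> fg; apply: (big_rec2 eqXn1 (eqXn1_refl 0)) => i x y _ [H1 E1].
by have [H2 E2] := fg i; exists (H1 + H2); rewrite mulrDl -E1 -E2; ring.
Qed.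

Lemma eqXn1_modn k : 'X^(k %% q.-1) =x 'X^k.
Proof.
apply: eqXn1_sym; rewrite {1}(divn_eq k q.-1) exprD -[X in _ =x X]mul1r.
apply: eqXn1M (eqXn1_refl _); rewrite mulnC exprM.
by eexists; rewrite subrX1 mulrC.
Qed.

(** At most one indicator is nonzero, so this is x^j or 0. Its domain is the fraction field and its
    test is that of [epsilon], so that it applies directly to the values of F_m. *)
Definition dlog_poly (z : {fraction V}) : {poly int} :=
  \sum_(j < q.-1)
    (`[< exists2 a : V, z = a%:F & max_ideal (a - wp ^ j) >] : nat)%:R *: 'X^j.

Lemma dlog_poly_tofrac a :
  dlog_poly a%:F = \sum_(j < q.-1) ((a =m wp ^+ j) : nat)%:R *: 'X^j.
Proof.
apply: eq_bigr => j _; congr ((nat_of_bool _)%:R *: _).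
apply/asboolP/idP => [[b /eqP]|aj]; last by exists a.
by rewrite tofrac_eq => /eqP ->.
Qed.

Lemma dlog_poly_max_ideal a : max_ideal a -> dlog_poly a%:F = 0.
Proof.
move=> ma; rewrite dlog_poly_tofrac big1 // => j _.
suff /negbTE -> : ~~ (a =m wp ^+ j) by rewrite scale0r.
by apply: contraL ma => /congm_max_ideal ->; apply: unit_wpX.
Qed.

Lemma dlog_polyE a (j : 'I_q.-1) : a =m wp ^+ j -> dlog_poly a%:F = 'X^j.
Proof.
move=> aj; rewrite dlog_poly_tofrac (bigD1 j) //= aj scale1r big1 ?addr0 //.
move=> k; apply: contraNeq; case: (boolP (a =m _)) => [ak _|]; last first.
  by rewrite scale0r eqxx.
by apply/eqP/dlog_inj; apply: congm_trans aj; rewrite congm_sym.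
Qed.

(** Both sides vanish if a factor is a nonunit. For units the logarithms add modulo q - 1, as do
    exponents of x modulo x^(q-1) - 1. *)
Lemma dlog_polyM a b : dlog_poly (a * b)%:F =x dlog_poly a%:F * dlog_poly b%:F.
Proof.
have [ma|ua] := boolP (max_ideal a).
  rewrite dlog_poly_max_ideal ?max_idealM ?ma // (dlog_poly_max_ideal ma) mul0r.
  exact: eqXn1_refl.
have [mb|ub] := boolP (max_ideal b).
  rewrite dlog_poly_max_ideal ?max_idealM ?mb ?orbT //.
  by rewrite (dlog_poly_max_ideal mb) mulr0; apply: eqXn1_refl.
have [i ai] := dlog_exists ua; have [j bj] := dlog_exists ub.
have [k abk] : exists k : 'I_q.-1, nat_of_ord k = ((i + j) %% q.-1)%N.
  by exists (Ordinal (ltn_pmod (i + j) (leq_ltn_trans (leq0n _) (ltn_ord i)))).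
rewrite (dlog_polyE ai) (dlog_polyE bj) (@dlog_polyE _ k).
  by rewrite abk -exprD; apply: eqXn1_modn.
by rewrite abk; apply: congm_trans (wpX_modn _); rewrite exprD congmM.
Qed.

Lemma dlog_poly_congm a b : a =m b -> dlog_poly a%:F = dlog_poly b%:F.
Proof.
move=> ab; rewrite !dlog_poly_tofrac; apply: eq_bigr => j _.
congr ((nat_of_bool _)%:R *: _); apply/idP/idP; apply: congm_trans => //.
by rewrite congm_sym.
Qed.

(** * Multiplicativity of the generating polynomials over digits *)

Local Notation G := (genpoly pi r wp).

(** Exchanging the sums over exponents and over m turns the counts into monomials. The bound [N] is
    left free so that whole blocks can be summed. *)
Lemma genpolyE n N : (n < N)%N -> G n = \sum_(m < N) dlog_poly (Fval m n).
Proof.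
move=> ltnN; rewrite -(subnKC ltnN) big_split_ord /= [X in _ + X]big1 ?addr0.
  rewrite /genpoly /dlog_poly exchange_big /=; apply: eq_bigr => j _.
  rewrite -scaler_suml -natr_sum /epsilon -sum1_card big_mkcond; congr (_%:R *: _).
  by apply: eq_bigr => m _; rewrite inE; case: asboolP.
move=> i _; rewrite Fval_eq0 -?tofrac0 ?dlog_poly_max_ideal ?max_ideal0 //.
by rewrite ltnS leq_addr.
Qed.

Lemma genpoly_rec n d : (d < q)%N -> G (n * q + d) =x G n * G d.
Proof.
move=> ltdq; rewrite (@genpolyE _ (n.+1 * q)); last by rewrite mulSn; lia.
rewrite (genpolyE (ltnSn n)) (genpolyE ltdq).
rewrite -(big_mkord xpredT (fun m => dlog_poly (Fval m (n * q + d)))).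
rewrite big_nat_mul big_mkord mulr_suml; apply: eqXn1_sum => m.
rewrite -{1}[(m * q)%N]add0n big_addn mulSn addnK big_mkord mulr_sumr.
apply: eqXn1_sum => c; rewrite (addnC c).
have [a [b [-> -> ab]]] := Fval_rec m n (ltn_ord c) ltdq.
have [e ->] := Fval_integral m n.
by rewrite -tofracM -(dlog_poly_congm ab); apply: dlog_polyM.
Qed.

Lemma genpoly_digits n : G n =x \prod_(j <- digits q n) G j.
Proof.
elim/ltn_ind: n => n IHn; have [ltnq|leqn] := ltnP n q.
  by rewrite digits_small // big_seq1; apply: eqXn1_refl.
have lt_div : (n %/ q < n)%N by rewrite ltn_Pdiv // (leq_trans q_gt0).
rewrite {1 2}(divn_eq n q) digits_rec ?ltn_pmod ?divn_gt0 // big_cons mulrC.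
apply: eqXn1_trans (eqXn1M (IHn _ lt_div) (eqXn1_refl _)).
exact/genpoly_rec/ltn_pmod.
Qed.

End LucasCongruence.

(** If pi were 0, every nonzero element of V would be a unit; an element of valuation 1 would then
    have its inverse, of valuation -1, in V. *)
Lemma uniformizer_neq0 (V : idomainType) (pi : V) :
  discrete_valuation_domain V -> max_ideal_generator pi -> pi != 0.
Proof.
move=> [v [vM _ v_surj] vP] pi_gen; apply: contraT; rewrite negbK => /eqP pi0.
have [x x0 vx] := v_surj 1.
have v1 : v 1 = 0.
  have /eqP := vM 1 1 (oner_neq0 _) (oner_neq0 _).
  by rewrite mul1r -[X in X == _]addr0 (inj_eq (addrI _)) => /eqP.
have [a xa] : exists a : V, x = a%:F by apply/vP; right; rewrite vx.
have ua : a \is a GRing.unit.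
  apply: contraT => /pi_gen[y]; rewrite pi0 mul0r => a0.
  by rewrite xa a0 tofrac0 eqxx in x0.
have : exists b : V, x^-1 = b%:F by exists a^-1; rewrite xa rmorphV.
have := vM x x^-1 x0; rewrite invr_eq0 divff // v1 vx => /(_ x0) vV.
by move/vP => [/eqP|]; [rewrite invr_eq0 (negbTE x0) | lia].
Qed.

Theorem theorem3p6 (V : idomainType) (pi : V) (q : nat) (r : q.-tuple V)
    (wp : V) (n : nat) :
  discrete_valuation_domain V ->
  max_ideal_generator pi ->
  residue_system r ->
  r`_0 = 0 ->
  residue_unit_generator wp ->
  exists H : {poly int},
    genpoly pi r wp n -
      \prod_(j < q) genpoly pi r wp j ^+ digit_count q j n
    = H * ('X^(q.-1) - 1).
Proof.
move=> dvd pi_gen r_sys r0 wp_gen.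
have pi_neq0 := uniformizer_neq0 dvd pi_gen.
have q_gt0 := ltnW (residue_card_gt1 pi_gen r_sys).
rewrite -(prod_digits n (genpoly pi r wp) q_gt0).
exact: genpoly_digits.
Qed.
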